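(* Let $k,\ell\ge 2$ be distinct integers, and define $a:=\binom{k}{2}$ and $b:=\binom{\ell}{2}$. If, for some integer $n\ge 2$, there exist numbers $p,x,y\in(0,1)$ such that $$p^{a}\le x\,(1-x)^{\varepsilon'}\,(1-y)^{\vartheta'},$$ $$(1-p)^{b}\le y\,(1-x)^{\varphi'}\,(1-y)^{\rho'},$$ where $$\varepsilon':=\binom{n}{k}-\binom{n-k}{k}-k\binom{n-k}{k-1}-1,\qquad \vartheta':=\binom{n}{\ell}-\binom{n-k}{\ell}-k\binom{n-k}{\ell-1},$$ $$\varphi':=\binom{n}{k}-\binom{n-\ell}{k}-\ell\binom{n-\ell}{k-1},\qquad \rho':=\binom{n}{\ell}-\binom{n-\ell}{\ell}-\ell\binom{n-\ell}{\ell-1}-1,$$ then $R(k,\ell)>n$.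
   Context: For integers $k,\ell\ge 2$, the Ramsey number $R(k,\ell)$ is the smallest integer $n\ge 2$ such that every $2$-coloring of the edges of the complete graph $K_n$ contains either a monochromatic copy of $K_k$ in the first color or a monochromatic copy of $K_\ell$ in the second color. Convention: $\binom{s}{t}=0$ whenever $s<t$ (including negative $s$). *)

(* Defs.v *)
From HB Require Import structures.
From mathcomp Require Import all_boot all_order all_algebra.
From mathcomp Require Import reals.

Set Implicit Arguments.
Unset Strict Implicit.
Unset Printing Implicit Defensive.

Import Order.TTheory GRing.Theory Num.Theory.

Definition edge (n : nat) := {e : {set 'I_n} | #|e| == 2}.

(* [true] is the first colour, [false] the second. *)
Definition edge_coloring (n : nat) := {ffun edge n -> bool}.

Definition has_mono_clique (n : nat) (c : edge_coloring n) (col : bool)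
    (k : nat) : bool :=
  [exists S : {set 'I_n},
    (#|S| == k) && [forall e : edge n, (val e \subset S) ==> (c e == col)]].

Definition ramsey_prop (k l n : nat) : bool :=
  [forall c : edge_coloring n,
    has_mono_clique c true k || has_mono_clique c false l].

(* Ramsey's theorem, needed for the minimum below to exist. *)
Lemma ramsey_rel (k l : nat) : exists N, forall (T : finType) (r : rel T)
    (A : {set T}), symmetric r -> N <= #|A| ->
  (exists S : {set T}, [/\ S \subset A, #|S| = k &
     {in S &, forall x y, x != y -> r x y}]) \/
  (exists S : {set T}, [/\ S \subset A, #|S| = l &
     {in S &, forall x y, x != y -> ~~ r x y}]).
Proof.
elim: k l => [|k IHk] l.
  exists 0 => T r A _ _; left; exists set0.
  by rewrite sub0set cards0; split=> // x y; rewrite inE.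
elim: l => [|l [N2 IHl]].
  exists 0 => T r A _ _; right; exists set0.
  by rewrite sub0set cards0; split=> // x y; rewrite inE.
have [N1 IH1] := IHk l.+1.
exists (N1 + N2).+1 => T r A rsym hA.
have /card_gt0P[v vA] : 0 < #|A| by apply: leq_trans hA.
pose B1 := [set x in A :\ v | r v x]; pose B2 := [set x in A :\ v | ~~ r v x].
have hB : N1 + N2 <= #|B1| + #|B2|.
  rewrite (cardsD1 v) vA ltnS in hA; apply: (leq_trans hA).
  rewrite -(cardsID [set x | r v x] (A :\ v)) leq_add //; apply: subset_leq_card;
    by apply/subsetP => x; rewrite !inE // andbC.
have add (B S : {set T}) (q : rel T) (m : nat) : symmetric q ->
    {in B, forall x, q v x} -> B \subset A :\ v -> S \subset B -> #|S| = m ->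
    {in S &, forall x y, x != y -> q x y} ->
    exists S : {set T}, [/\ S \subset A, #|S| = m.+1 &
      {in S &, forall x y, x != y -> q x y}].
  move=> qsym qv sBA sSB cS qS; exists (v |: S).
  have sSA := subset_trans sSB sBA.
  have vS : v \notin S by apply: contraL sSA => vS;
    apply/negP => /subsetP/(_ v vS); rewrite !inE eqxx.
  split; last first.
  - move=> x y /setU1P[->|xS] /setU1P[->|yS]; rewrite ?eqxx // => xy.
    + by apply: qv; apply: (subsetP sSB).
    + by rewrite qsym; apply: qv; apply: (subsetP sSB).
    + exact: qS.
  - by rewrite cardsU1 vS cS.
  - rewrite subUset sub1set vA /=.
    exact: subset_trans sSA (subD1set _ _).
have sB1 : B1 \subset A :\ v by apply/subsetP => x; rewrite inE => /andP[].
have sB2 : B2 \subset A :\ v by apply/subsetP => x; rewrite inE => /andP[].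
have sA := subD1set A v.
have [h1|h1] := leqP N1 #|B1|.
  have [[S [sS cS hS]]|[S [sS cS hS]]] := IH1 T r B1 rsym h1; last first.
    right; exists S; split=> //.
    exact: subset_trans (subset_trans sS sB1) sA.
  left; apply: (add B1 S r k) => // x; by rewrite inE => /andP[].
have h2 : N2 <= #|B2|.
  rewrite -(leq_add2l N1); apply: (leq_trans hB); rewrite leq_add2r; exact: ltnW.
have [[S [sS cS hS]]|[S [sS cS hS]]] := IHl T r B2 rsym h2.
  left; exists S; split=> //.
  exact: subset_trans (subset_trans sS sB2) sA.
right; apply: (add B2 S (fun x y => ~~ r x y) l) => //.
  by move=> x y; rewrite rsym.
by move=> x; rewrite inE => /andP[].
Qed.

Lemma ramsey_exists (k l : nat) : exists n, (2 <= n) && ramsey_prop k l n.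
Proof.
have [N hN] := ramsey_rel k l; exists (maxn 2 N); rewrite leq_maxl /=.
set n := maxn 2 N; apply/forallP => c.
pose r (x y : 'I_n) := oapp c false (insub [set x; y]).
have rsym : symmetric r by move=> x y; rewrite /r setUC.
have rE x y (e : edge n) : val e = [set x; y] -> r x y = c e.
  by move=> h; rewrite /r -h valK.
have hA : N <= #|[set: 'I_n]| by rewrite cardsT card_ord leq_maxr.
apply/orP; case: (hN _ r [set: 'I_n] rsym hA) => -[S [_ cS hS]]; [left|right];
  apply/existsP; exists S; rewrite cS eqxx /=; apply/forallP => e;
  apply/implyP => sS; have /cards2P[x [y [xy exy]]] := valP e;
  move: sS; rewrite exy subUset !sub1set => /andP[xS yS];
  have := hS x y xS yS xy; rewrite (rE x y e exy).
- by move=> ->.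
- by move=> /negbTE ->.
Qed.

Definition ramsey (k l : nat) : nat := ex_minn (ramsey_exists k l).

(* Binomial coefficient with integer upper entry, 0 when [s < t]. *)
Definition binz (s : int) (t : nat) : int :=
  if s is Posz m then Posz 'C(m, t) else 0%R.

(* Main.v *)
(** Colour each edge independently, with probability [p] for the first colour, and
    let the bad events be "the [k]-set [S] is monochromatic in the first colour"
    and "the [l]-set [T] is monochromatic in the second". An event is independent
    of those whose vertex sets meet its own in at most one vertex, so the
    asymmetric local lemma, with weight [x] on the events of the first kind and
    [y] on the others, yields a colouring that avoids all of them; the exponents
    in the hypotheses count the neighbours of an event. *)
Require Import Defs.
From mathcomp Require Import all_boot all_order all_algebra.
From mathcomp Require Import reals.

Import Order.TTheory GRing.Theory Num.Theory.
Local Open Scope ring_scope.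

(** * The local lemma on a finite weighted space *)

Definition mass {R : realDomainType} {T : finType} (w : T -> R) (E : {set T}) : R :=
  \sum_(t in E) w t.

Definition avoid {T I : finType} (A : I -> {set T}) (J : {set I}) : {set T} :=
  \bigcap_(i in J) ~: A i.

Lemma mass_ge0 {R : realDomainType} {T : finType} (w : T -> R) (E : {set T}) :
  (forall t, 0 <= w t) -> 0 <= mass w E.
Proof. by move=> w0; apply: sumr_ge0. Qed.

Lemma massS {R : realDomainType} {T : finType} (w : T -> R) (E F : {set T}) :
  (forall t, 0 <= w t) -> E \subset F -> mass w E <= mass w F.
Proof.
move=> w0 sEF; rewrite /mass [leRHS](big_setID E) /= (setIidPr sEF) lerDl.
exact: mass_ge0.
Qed.

Lemma mem_avoid {T I : finType} (A : I -> {set T}) (J : {set I}) t :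
  (t \in avoid A J) = [forall (i | i \in J), t \notin A i].
Proof.
apply/bigcapP/forall_inP => h i /h; first by rewrite inE.
by rewrite inE.
Qed.

Lemma mass_avoidU1 {R : realDomainType} {T I : finType} (w : T -> R)
    (A : I -> {set T}) (J : {set I}) i :
  mass w (avoid A J) = mass w (A i :&: avoid A J) + mass w (avoid A (i |: J)).
Proof.
rewrite /mass (big_setID (A i)) /= setIC; congr (_ + _).
apply: eq_bigl => t; congr (t \in _).
by rewrite /avoid bigcap_setU big_set1 setDE setIC.
Qed.

(** The chain rule: as the elements of [K :\: J] are added one at a time, each [i] removes at most
    the fraction [x i] of the remaining mass. Conditional bounds are written as products, so no
    conditioning set has to have positive mass. *)
Lemma mass_avoid_chain {R : realDomainType} {T I : finType} (w : T -> R)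
    (A : I -> {set T}) (x : I -> R) (J K : {set I}) :
  (forall i, x i <= 1) ->
  (forall i (L : {set I}), i \in K -> i \notin L -> L \subset K ->
    mass w (A i :&: avoid A L) <= x i * mass w (avoid A L)) ->
  J \subset K ->
  (\prod_(j in K :\: J) (1 - x j)) * mass w (avoid A J) <= mass w (avoid A K).
Proof.
move=> x1; have [m] := ubnP #|K|; elim: m K => // m IHm K leKm hK sJK.
have [/eqP|[i iKJ]] := set_0Vmem (K :\: J).
  rewrite setD_eq0 => sKJ; have -> : J = K by apply/eqP; rewrite eqEsubset sJK.
  by rewrite setDv big_set0 mul1r.
have /setDP[iK iJ] := iKJ.
rewrite (big_setD1 i iKJ) /= -(setD1K iK) -mulrA.
have sDK := subD1set K i.
have -> : (i |: K :\ i) :\: J :\ i = (K :\ i) :\: J.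
  by apply/setP => z; rewrite !inE; case: (z == i); rewrite ?andbF ?andbT.
have {}IHm : \prod_(j in (K :\ i) :\: J) (1 - x j) * mass w (avoid A J)
    <= mass w (avoid A (K :\ i)).
  apply: IHm; last by rewrite subsetD1 sJK.
    by move: leKm; rewrite (cardsD1 i) iK.
  move=> j L jK jL sL; apply: hK => //; first exact: subsetP jK.
  exact: subset_trans sL sDK.
apply: (le_trans (ler_wpM2l _ IHm)); first by rewrite subr_ge0.
rewrite mulrBl mul1r lerBlDl [leLHS](mass_avoidU1 _ _ _ i) lerD2r.
by apply: hK; rewrite ?setD11.
Qed.

(** Induction on [#|J|]. Forgetting the neighbours of [i] in [J] can only raise the left side, and
    the hypothesis applies to the non-neighbours [J2]. The chain rule, fed by the induction
    hypothesis, then restores the neighbours at a cost covered by the product over [G i]. *)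
Lemma local_lemma_step {R : realDomainType} {T I : finType} (w : T -> R)
    (A : I -> {set T}) (x : I -> R) (G : rel I) :
  (forall t, 0 <= w t) -> (forall i, 0 <= x i <= 1) ->
  (forall i (J : {set I}), i \notin J -> (forall j, j \in J -> ~~ G i j) ->
    mass w (A i :&: avoid A J)
      <= x i * (\prod_(j | G i j) (1 - x j)) * mass w (avoid A J)) ->
  forall i (J : {set I}), i \notin J ->
    mass w (A i :&: avoid A J) <= x i * mass w (avoid A J).
Proof.
move=> w0 x01 hA i J; have [m] := ubnP #|J|; elim: m i J => // m IHm i J leJm iJ.
have x0 j : 0 <= x j by have /andP[] := x01 j.
have x1 j : x j <= 1 by have /andP[] := x01 j.
pose J2 := [set j in J | ~~ G i j].
have sJ2 : J2 \subset J by apply/subsetP => j; rewrite inE => /andP[].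
apply: (@le_trans _ _ (mass w (A i :&: avoid A J2))).
  apply: massS => //; apply: setIS; apply/subsetP => t; rewrite !mem_avoid.
  move=> /forall_inP h; apply/forall_inP => j /(subsetP sJ2); exact: h.
apply: le_trans (hA i J2 _ _) _.
- by apply: contra iJ; apply: subsetP.
- by move=> j; rewrite inE => /andP[].
rewrite -mulrA ler_wpM2l //.
apply: (@le_trans _ _ (\prod_(j in J :\: J2) (1 - x j) * mass w (avoid A J2))).
  rewrite ler_wpM2r ?mass_ge0 // (bigID (mem J)) /= [leLHS]mulrC.
  rewrite [leRHS](_ : _ = \prod_(j | G i j && (j \in J)) (1 - x j)); last first.
    apply: eq_bigl => j; rewrite !inE.
    by case: (j \in J); case: (G i j).
  rewrite ler_piMl ?prodr_ge0 //; first by move=> j _; rewrite subr_ge0.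
  by apply: prodr_ile1 => j _; rewrite subr_ge0 x1 lerBlDr lerDl x0.
apply: mass_avoid_chain => // j L jJ jL sLJ; apply: IHm => //.
rewrite -ltnS; apply: leq_trans leJm; rewrite ltnS; apply: proper_card.
by apply/properP; split=> //; exists j.
Qed.

(* The local lemma in lopsided form: independence of [A i] from its non-neighbours
   is weakened to an upper bound on the correlation. *)
Lemma local_lemma {R : realDomainType} {T I : finType} (w : T -> R)
    (A : I -> {set T}) (x : I -> R) (G : rel I) :
  (forall t, 0 <= w t) -> 0 < \sum_t w t -> (forall i, 0 <= x i < 1) ->
  (forall i (J : {set I}), i \notin J -> (forall j, j \in J -> ~~ G i j) ->
    mass w (A i :&: avoid A J)
      <= x i * (\prod_(j | G i j) (1 - x j)) * mass w (avoid A J)) ->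
  exists t, forall i, t \notin A i.
Proof.
move=> w0 wT x01 hA.
have x01' i : 0 <= x i <= 1 by have /andP[-> /ltW] := x01 i.
have x1 i : x i <= 1 by have /andP[] := x01' i.
have step := local_lemma_step w A x G w0 x01' hA.
(* Chaining from the empty set to all indices leaves at least the total mass times the product of
   all [1 - x i], which is positive. *)
have := mass_avoid_chain w A x set0 setT x1
  (fun i L _ iL _ => step i L iL) (sub0set _).
have [E0|[t tA] _] := set_0Vmem (avoid A [set: I]); last first.
  by exists t => i; move: tA; rewrite mem_avoid => /forall_inP; apply; rewrite inE.
rewrite E0 {2}/mass big_set0 leNgt => /negP[]; apply: mulr_gt0.
  by apply: prodr_gt0 => i _; rewrite subr_gt0; have /andP[] := x01 i.
by rewrite /mass /avoid big_set0 (eq_bigl predT) // => t; rewrite inE.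
Qed.

(** * Product weights and independence *)

Definition product_weight {R : comNzRingType} {I V : finType} (q : I -> V -> R)
    (f : {ffun I -> V}) : R := \prod_i q i (f i).

Definition splice {I V : finType} (X : {set I}) (f g : {ffun I -> V}) :=
  [ffun i => if i \in X then f i else g i].

(* Exchanging the coordinates in [X] between two independent samples preserves
   their joint law. *)
Lemma mass_indep {R : realDomainType} {I V : finType} (q : I -> V -> R)
    (X : {set I}) (E F : {set {ffun I -> V}}) :
  (forall f g, (splice X f g \in E) = (f \in E)) ->
  (forall f g, (splice X f g \in F) = (g \in F)) ->
  let w := product_weight q in
  mass w E * mass w F = mass w (E :&: F) * mass w setT.
Proof.
move=> hE hF w; rewrite /mass !big_distrlr /= !pair_big /=.
pose s (u : {ffun I -> V} * {ffun I -> V}) := (splice X u.1 u.2, splice X u.2 u.1).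
have sK : involutive s.
  by move=> [f g]; congr pair; apply/ffunP => i; rewrite !ffunE /=; case: (i \in X).
rewrite [RHS](reindex_inj (inv_inj sK)) /=; apply: eq_big => [[f g]|[f g] _] /=.
  by rewrite !inE andbT hE hF.
rewrite /w /product_weight -!big_split /=; apply: eq_bigr => i _.
by rewrite !ffunE; case: ifP => // _; rewrite mulrC.
Qed.

Lemma product_weight_total {R : comNzRingType} {I V : finType} (q : I -> V -> R) :
  (forall i, \sum_v q i v = 1) -> \sum_f product_weight q f = 1.
Proof.
by move=> q1; rewrite -(bigA_distr_bigA q) big1.
Qed.

Lemma mass_constant {R : realDomainType} {I V : finType} (q : I -> V -> R)
    (X : {set I}) (v : V) :
  (forall i, \sum_u q i u = 1) ->
  mass (product_weight q) [set f : {ffun I -> V} | [forall (i | i \in X), f i == v]]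
    = \prod_(i in X) q i v.
Proof.
(* The event is a product set: coordinates in [X] are forced, the others are free and each sums to
   1. *)
move=> q1; pose P i := [pred u | (i \in X) ==> (u == v)].
rewrite /mass (eq_bigl (fun f => f \in family P)); last first.
  by move=> f; rewrite inE; apply: eq_forallb => i.
rewrite -(bigA_distr_big_dep P) (bigID (mem X)) /= [X in _ * X]big1 ?mulr1.
  by apply: eq_bigr => i iX; rewrite (big_pred1 v) // => u; rewrite /= iX.
by move=> i /negbTE iX; rewrite -(q1 i); apply: eq_bigl => u; rewrite /= iX.
Qed.

(** * Counting the sets that share an edge with a given set *)

(** The [m]-subsets are sorted by whether they meet [S] in at least two, exactly one or no elements.
    The additive form makes the truncated subtractions in [meet_count] exact. *)
Lemma card_draws_meet_le1 (T : finType) (S : {set T}) (m : nat) : (0 < m)%N ->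
  'C(#|T|, m) = (#|[set U : {set T} | (#|U| == m) && (1 < #|S :&: U|)%N]|
    + #|S| * 'C(#|T| - #|S|, m - 1) + 'C(#|T| - #|S|, m))%N.
Proof.
move=> m0; rewrite -card_draws.
have cC : #|~: S| = (#|T| - #|S|)%N by rewrite cardsCs setCK.
rewrite -(cardsID [set U : {set T} | (1 < #|S :&: U|)%N]).
rewrite -addnA; congr (_ + _)%N; first by apply: eq_card => U; rewrite !inE.
rewrite -(cardsID [set U : {set T} | #|S :&: U| == 1%N]) -cC; congr (_ + _)%N.
  rewrite -cards_draws -cardsX.
  (* A set meeting [S] only in [v] corresponds to the pair of [v] and its other [m - 1] elements,
     which lie outside [S]. *)
  pose f (u : T * {set T}) := u.1 |: u.2.
  rewrite -(card_in_imset (f := f)); last first.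
    move=> [v U] [v' U']; rewrite !inE /f /= => /and3P[vS sU _] /and3P[vS' sU' _] E.
    have vU : v \notin U by apply: contraL vS => /(subsetP sU); rewrite inE.
    have vU' : v' \notin U' by apply: contraL vS' => /(subsetP sU'); rewrite inE.
    have vv' : v = v'.
      have : v \in v' |: U' by rewrite -E setU11.
      case/setU1P => // /(subsetP sU'); by rewrite inE vS.
    by congr pair => //; rewrite -(setU1K vU) -(setU1K vU') E vv'.
  apply: eq_card => U; apply/idP/imsetP.
    rewrite !inE => /andP[/andP[_ /eqP cU] /cards1P[v SU]].
    have /setIP[vS vU] : v \in S :&: U by rewrite SU set11.
    exists (v, U :\ v); last by rewrite /f /= setD1K.
    rewrite !inE /= vS -cU (cardsD1 v U) vU add1n subn1 eqxx andbT /=.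
    apply/subsetP => t /setD1P[tv tU]; rewrite inE; apply: contra tv => tS.
    by rewrite -in_set1 -SU inE tS.
  move=> [[v V]]; rewrite !inE /f /= => /and3P[vS sV /eqP cV] ->.
  have vV : v \notin V by apply: contraL vS => /(subsetP sV); rewrite inE.
  have -> : S :&: (v |: V) = [set v].
    apply/setP => t; rewrite !inE; case: eqVneq => [->|_] /=; first by rewrite vS.
    by apply/negP => /andP[tS /(subsetP sV)]; rewrite inE tS.
  by rewrite cards1 cardsU1 vV cV add1n subn1 prednK ?eqxx.
rewrite -cards_draws; apply: eq_card => U; rewrite !inE.
rewrite subsets_disjoint setCK disjoint_sym -setI_eq0 -cards_eq0.
by case: #|S :&: U| => [|[|c]]; rewrite ?andbF ?andbT.
Qed.

(* The number of [m]-subsets of an [n]-set that share at least two elements, hence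
   an edge, with a given [s]-subset. *)
Definition meet_count (n s m : nat) : nat :=
  ('C(n, m) - 'C(n - s, m) - s * 'C(n - s, m - 1))%N.

Lemma card_meet (n m : nat) (S : {set 'I_n}) : (0 < m)%N ->
  #|[set U : {set 'I_n} | (#|U| == m) && (1 < #|S :&: U|)%N]| = meet_count n #|S| m.
Proof.
move=> m0; have := card_draws_meet_le1 _ S m m0; rewrite card_ord /meet_count => ->.
by rewrite addnK addnK.
Qed.

Lemma exists_set_card (n s : nat) : (s <= n)%N -> exists S : {set 'I_n}, #|S| = s.
Proof.
move=> sn; have : (0 < #|[set S : {set 'I_n} | #|S| == s]|)%N.
  by rewrite card_draws card_ord bin_gt0.
by case/card_gt0P => S; rewrite inE => /eqP; exists S.
Qed.

(** The given set counts itself. Hence the final [- 1] in [eps] and [rho] agrees with truncated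
    subtraction. *)
Lemma meet_count_diag_gt0 (n s : nat) : (1 < s <= n)%N -> (0 < meet_count n s s)%N.
Proof.
case/andP => s1 /exists_set_card[S cS]; rewrite -{1}cS -card_meet; last exact: ltnW.
by apply/card_gt0P; exists S; rewrite inE setIid cS eqxx.
Qed.

Lemma binz_meet_count (n s m : nat) : (s <= n)%N -> (0 < m)%N ->
  binz n m - binz (n%:Z - s%:Z) m - s%:Z * binz (n%:Z - s%:Z) (m - 1)
    = (meet_count n s m)%:Z.
Proof.
move=> sn m0; have [S cS] := exists_set_card _ _ sn.
have := card_draws_meet_le1 _ S m m0; rewrite card_meet // cS card_ord subzn //= => ->.
by rewrite !PoszD PoszM addrK addrK.
Qed.

(** * Monochromatic cliques and monotonicity in the number of vertices *)

Lemma card_edges_in (n : nat) (S : {set 'I_n}) :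
  #|[set e : edge n | val e \subset S]| = 'C(#|S|, 2).
Proof.
rewrite -cards_draws -(card_imset _ val_inj); apply: eq_card => U.
apply/imsetP/idP => [[e]|]; first by rewrite !inE => sS ->; rewrite sS (valP e).
by rewrite inE => /andP[sS cU]; exists (Sub U cU); rewrite ?inE SubK.
Qed.

(** A colouring of the larger graph restricts to the first [m] vertices, and cliques embed back.
    Since [ramsey] is a minimum, one good colouring at [n] thereby excludes every value up to
    [n]. *)
Lemma ramsey_prop_mono (k l m n : nat) :
  (m <= n)%N -> ramsey_prop k l m -> ramsey_prop k l n.
Proof.
move=> mn /forallP hm; apply/forallP => c.
pose f := widen_ord mn.
have fI : injective f by move=> i j /(congr1 val) /= /val_inj.
(* The default [false] is never reached: the injective image of an edge has two elements. *)
pose c' : edge_coloring m := [ffun e : edge m => oapp c false (insub (f @: val e))].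
have lift col s : has_mono_clique c' col s -> has_mono_clique c col s.
  case/existsP => S /andP[cS /forallP hS]; apply/existsP; exists (f @: S).
  rewrite card_imset // cS; apply/forallP => e; apply/implyP => se.
  have eE : f @: (f @^-1: val e) = val e.
    apply/setP => t; apply/imsetP/idP => [[u]|te]; first by rewrite inE => ? ->.
    have /imsetP[u _ tu] := subsetP se t te.
    by exists u; rewrite ?inE -?tu.
  have ce : #|f @^-1: val e| == 2 by rewrite -(card_imset _ fI) eE (valP e).
  have := hS (Sub (f @^-1: val e) ce); rewrite SubK ffunE SubK eE valK /= => /implyP.
  apply; apply/subsetP => u; rewrite inE => /(subsetP se).
  by rewrite mem_imset.
by have /orP[/lift|/lift] := hm c' => ->; rewrite ?orbT.
Qed.

Lemma constant_no_mono_clique (n : nat) (b : bool) (s : nat) : (2 <= s)%N ->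
  ~~ has_mono_clique ([ffun=> b] : edge_coloring n) (~~ b) s.
Proof.
move=> s2; apply/existsP => -[S /andP[/eqP cS /forallP hS]].
have : (0 < #|[set e : edge n | val e \subset S]|)%N by rewrite card_edges_in cS bin_gt0.
case/card_gt0P => e; rewrite inE => sS.
by have := hS e; rewrite sS ffunE /=; case: (b).
Qed.

Lemma no_large_clique (n : nat) (c : edge_coloring n) (col : bool) (s : nat) :
  (n < s)%N -> ~~ has_mono_clique c col s.
Proof.
move=> ns; apply/existsP => -[S /andP[/eqP cS _]]; move: ns.
by rewrite -cS ltnNge -[n in (_ <= n)%N]card_ord max_card.
Qed.

(** * The local lemma applied to random colourings *)

(** Indexing by the colour treats both kinds of bad events at once. Subtracting [col == col']
    removes an event from the count of its own neighbours. *)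
Lemma coloring_without_mono_cliques (R : realDomainType) (n : nat)
    (sz : bool -> nat) (q z : bool -> R) :
  (forall col, 2 <= sz col)%N ->
  (forall col, 0 <= q col) -> \sum_col q col = 1 -> (forall col, 0 <= z col < 1) ->
  (forall col, q col ^+ 'C(sz col, 2) <= z col *
    \prod_col' (1 - z col') ^+ (meet_count n (sz col) (sz col') - (col == col'))) ->
  exists c : edge_coloring n, forall col, ~~ has_mono_clique c col (sz col).
Proof.
move=> sz2 q0 q1 z01 hq.
(* Sets of the wrong size carry the empty event with weight [0], so that they do
   not contribute to the products of the local lemma. *)
pose I := (bool * {set 'I_n})%type.
pose ok (i : I) := #|i.2| == sz i.1.
pose X (i : I) := [set e : edge n | val e \subset i.2].
pose A (i : I) := if ok i then
  [set c : edge_coloring n | [forall (e | e \in X i), c e == i.1]] else set0.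
pose x (i : I) := if ok i then z i.1 else 0.
pose G (i j : I) := [&& j != i, ok j & (1 < #|i.2 :&: j.2|)%N].
pose q' (e : edge n) := q.
pose w := product_weight q'.
have w0 c : 0 <= w c by apply: prodr_ge0.
have w1 : \sum_c w c = 1 by apply: product_weight_total.
have spA i f g : (splice (X i) f g \in A i) = (f \in A i).
  rewrite /A; case: (ok i); rewrite !inE //.
  by apply: eq_forallb_in => e eX; rewrite ffunE eX.
(* An edge inside both vertex sets would give two common vertices, so the events of [J] never look
   at the edges in [X i]. *)
have indep i (J : {set I}) : i \notin J -> (forall j, j \in J -> ~~ G i j) -> forall f g,
    (splice (X i) f g \in avoid A J) = (g \in avoid A J).
  move=> iJ GJ f g; rewrite !mem_avoid; apply: eq_forallb_in => j jJ; congr (~~ _).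
  rewrite /A; case: ifP => [okj|]; rewrite !inE //.
  have ji : j != i by apply: contraNneq iJ => <-.
  apply: eq_forallb_in => e; rewrite inE => ej; rewrite ffunE inE ifN //.
  apply: contra (GJ j jJ) => ei; rewrite /G ji okj /=.
  by rewrite -(eqP (valP e)) subset_leq_card // subsetI ei ej.
have [c hc] : exists c, forall i, c \notin A i; last first.
  exists c => col; apply/existsP => -[S /andP[cS /forallP hS]].
  have := hc (col, S); rewrite /A /ok /= cS inE => /negP[]; apply/forallP => e.
  by rewrite inE.
apply: (local_lemma w A x G w0) => [|i|i J iJ GJ].
- by rewrite w1 ltr01.
- by rewrite /x; case: ifP => // _; rewrite lexx ltr01.
- have := mass_indep q' (X i) (A i) (avoid A J) (spA i) (indep i J iJ GJ).
  rewrite /= -/w [X in _ = _ * X](_ : _ = 1) ?mulr1; last first.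
    by rewrite -w1 /mass; apply: eq_bigl => c; rewrite in_setT.
  move=> <-; rewrite ler_wpM2r ?mass_ge0 // /x /A; case: ifP => oki; last first.
    by rewrite mul0r /mass big_set0.
  rewrite mass_constant // prodr_const card_edges_in (eqP oki).
  apply: le_trans (hq _) _; rewrite le_eqVlt; apply/orP; left; apply/eqP.
  (* The two products agree: sorted by colour, the neighbours of [i] are exactly as many as the
     exponents say. *)
  congr (_ * _).
  rewrite [RHS](eq_bigr (fun j => 1 - z j.1)); last first.
    by move=> j /and3P[_ okj _]; rewrite okj.
  transitivity (\prod_(j : I | xpredT j.1 && G i (j.1, j.2)) (1 - z j.1)); last first.
    by apply: eq_bigl => -[].
  rewrite -(pair_big_dep xpredT (fun b U => G i (b, U)) (fun b _ => 1 - z b)) /=.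
  apply: eq_bigr => b _.
  pose D := [set U : {set 'I_n} | (#|U| == sz b) && (1 < #|i.2 :&: U|)%N].
  have cD : #|D| = meet_count n (sz i.1) (sz b).
    by rewrite card_meet ?(eqP oki) // ltnW.
  have iE U : ((b, U) == i) = (b == i.1) && (U == i.2) by case: (i).
  rewrite (eq_bigl (fun U => U \in if i.1 == b then D :\ i.2 else D)); last first.
    by move=> U; rewrite /G iE eq_sym; case: ifP => _; rewrite !inE.
  rewrite prodr_const -cD; congr (_ ^+ _); case: eqVneq => [ib|ib].
    have iD : i.2 \in D by rewrite inE setIid -ib (eqP oki) eqxx sz2.
    by rewrite (cardsD1 i.2 D) iD addKn.
  by rewrite subn0.
Qed.

Theorem theorem9 (R : realType) (k l : nat) (hk : (2 <= k)%N) (hl : (2 <= l)%N)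
    (hkl : k <> l) (n : nat) (hn : (2 <= n)%N) :
  let a := 'C(k, 2) in
  let b := 'C(l, 2) in
  let eps := binz n k - binz (n%:Z - k%:Z) k
               - k%:Z * binz (n%:Z - k%:Z) (k - 1) - 1 in
  let theta := binz n l - binz (n%:Z - k%:Z) l
               - k%:Z * binz (n%:Z - k%:Z) (l - 1) in
  let phi := binz n k - binz (n%:Z - l%:Z) k
               - l%:Z * binz (n%:Z - l%:Z) (k - 1) in
  let rho := binz n l - binz (n%:Z - l%:Z) l
               - l%:Z * binz (n%:Z - l%:Z) (l - 1) - 1 in
  (exists p x y : R,
    [/\ 0 < p < 1, 0 < x < 1, 0 < y < 1,
        p ^+ a <= x * (1 - x) ^ eps * (1 - y) ^ theta &
        (1 - p) ^+ b <= y * (1 - x) ^ phi * (1 - y) ^ rho]) ->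
  (n < ramsey k l)%N.
Proof.
move=> a b eps theta phi rho [p [x [y [/andP[p0 p1] x01 y01 hp hq]]]].
suff [c ck cl] : exists2 c : edge_coloring n,
    ~~ has_mono_clique c true k & ~~ has_mono_clique c false l.
  rewrite /ramsey; case: ex_minnP => m /andP[_ hm] _; rewrite ltnNge.
  apply/negP => /ramsey_prop_mono/(_ hm)/forallP/(_ c).
  by rewrite (negbTE ck) (negbTE cl).
(* If [n < k], then [eps] is [-1] and is not a neighbour count; but no [k]-clique fits, so a single
   colour suffices. The case [n < l] is alike. *)
have [nk|kn] := ltnP n k.
  exists [ffun=> true]; first exact: no_large_clique.
  exact: (constant_no_mono_clique n true).
have [nl|ln] := ltnP n l.
  exists [ffun=> false]; last exact: no_large_clique.
  exact: (constant_no_mono_clique n false).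
have diag s : (2 <= s)%N -> (s <= n)%N ->
    (meet_count n s s)%:Z - 1 = (meet_count n s s - 1)%N%:Z.
  by move=> s2 sn; rewrite subzn // meet_count_diag_gt0 ?s2.
have k0 := ltnW hk; have l0 := ltnW hl.
rewrite /eps /theta !binz_meet_count // diag // in hp.
rewrite /phi /rho !binz_meet_count // diag // in hq.
have [|||||c hc] := @coloring_without_mono_cliques R n (fun col => if col then k else l)
  (fun col => if col then p else 1 - p) (fun col => if col then x else y).
- by case.
- by case; rewrite ?subr_ge0 ltW.
- by rewrite big_bool /= addrC subrK.
- by case; [move: x01|move: y01] => /andP[/ltW-> ->].
- by case; rewrite big_bool /= subn0 mulrA.
by exists c; [apply: (hc true)|apply: (hc false)].
Qed.
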